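(* Let $N\ge2$ and $\bar\nu\ge0$. For the harmonic particle chain with zero exterior potential, interaction potential $v_{\mathrm{int}}(r)=\frac{r^2}2$ and mass-matrix penalization $M_{\nu_N}=\mathrm{Id}-\bar\nu^2\Delta_d$, the leapfrog/Verlet integration with time step $\delta t>0$ of the penalized harmonic Hamiltonian $$H_{\nu_N}(p,q)=\tfrac12p^TM_{\nu_N}^{-1}p+\sum_{i=1}^{N-1}v_{\mathrm{int}}(\nabla^d_iq)$$ is stable in the spectral sense if and only if $$\delta t\le\left(4\bar\nu^2+\frac1{N^2\sin^2\left(\frac{(N-1)\pi}{2N}\right)}\right)^{1/2}.$$
   Context: $q,p\in\mathbb{R}^N$. The discrete gradient $\nabla^d:\mathbb{R}^N\to\mathbb{R}^{N-1}$ is $\nabla^d_iq=N(q_{i+1}-q_i)$, $i=1,\dots,N-1$, and $\Delta_d=-(\nabla^d)^T\nabla^d$ is the discrete Neumann Laplacian. The leapfrog scheme is $$p_{n+1/2}=p_n+\tfrac{\delta t}2\Delta_dq_n,\quad q_{n+1}=q_n+\delta t\,M_{\nu_N}^{-1}p_{n+1/2},\quad p_{n+1}=p_{n+1/2}+\tfrac{\delta t}2\Delta_dq_{n+1}.$$ Stability in the spectral sense means that all eigenvalues of the linear one-step map have modulus at most $1$; equivalently, in the eigenbasis of $-\Delta_d$, each $2\times2$ one-step block $L_k$ (of determinant $1$) associated with a nonzero mode $k=1,\dots,N-1$ satisfies $|\mathrm{Tr}(L_k)|\le2$. *)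

(* Defs.v *)
From HB Require Import structures.
From mathcomp Require Import all_boot all_order all_algebra.
From mathcomp Require Import all_classical all_reals all_analysis.
From mathcomp Require Import complex ring lra.
Set Implicit Arguments.
Unset Strict Implicit.
Unset Printing Implicit Defensive.
Import Order.TTheory GRing.Theory Num.Theory.
Import numFieldNormedType.Exports.
Local Open Scope classical_set_scope.
Local Open Scope ring_scope.

(* Row i of the matrix is N * (e_(i+1) - e_i), see [dgradE]. *)
Definition dgrad {R : realType} (N : nat) : 'M[R]_(N.-1, N) :=
  \matrix_(i, j) (N%:R * ((j == i.+1 :> nat)%:R - (j == i :> nat)%:R)).

Definition dlaplacian {R : realType} (N : nat) : 'M[R]_N :=
  - ((dgrad N)^T *m dgrad N).

Definition mass {R : realType} (N : nat) (nu : R) : 'M[R]_N :=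
  1%:M - nu ^+ 2 *: dlaplacian N.

Definition v_int {R : realType} (r : R) : R := r ^+ 2 / 2.

Definition hamiltonian {R : realType} (N : nat) (nu : R) (p q : 'cV[R]_N) : R :=
  2^-1 * (p^T *m invmx (mass N nu) *m p) 0 0
  + \sum_(i < N.-1) v_int ((dgrad N *m q) i 0).

Definition gradient {R : realType} (n : nat) (f : 'cV[R]_n -> R) (x : 'cV[R]_n)
    : 'cV[R]_n :=
  \col_i 'D_(delta_mx i 0) f x.

(* Leapfrog step for a separable Hamiltonian H p q; for the chain it is the
   explicit scheme given in [leapfrog_hamiltonianE]. *)
Definition leapfrog {R : realType} (n : nat) (H : 'cV[R]_n -> 'cV[R]_n -> R)
    (dt : R) (p q : 'cV[R]_n) : 'cV[R]_n * 'cV[R]_n :=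
  let p_half := p - (dt / 2) *: gradient (H p) q in
  let q_new := q + dt *: gradient (H ^~ q) p_half in
  let p_new := p_half - (dt / 2) *: gradient (H p_half) q_new in
  (p_new, q_new).

(* Phase-space vectors stack p above q. *)
Definition one_step_map {R : realType} (n : nat)
    (H : 'cV[R]_n -> 'cV[R]_n -> R) (dt : R) (z : 'cV[R]_(n + n))
    : 'cV[R]_(n + n) :=
  let pq := leapfrog H dt (usubmx z) (dsubmx z) in col_mx pq.1 pq.2.

(* [eigenvalue] refers to row eigenvectors, which does not affect the spectrum
   of a square matrix; all complex eigenvalues are taken into account. *)
Definition spectrally_stable {R : realType} (m : nat)
    (Phi : 'cV[R]_m -> 'cV[R]_m) : Prop :=
  exists2 A : 'M[R]_m, (forall z, Phi z = A *m z) &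
    forall l : R[i],
      eigenvalue (map_mx (fun x : R => real_complex R x) A) l -> `|l| <= 1.

Lemma dgradE {R : realType} (N : nat) (q : 'cV[R]_N) (i : 'I_N.-1)
    (j j' : 'I_N) : j = i :> nat -> j' = i.+1 :> nat ->
  (dgrad N *m q) i 0 = N%:R * (q j' 0 - q j 0).
Proof.
move=> ji j'i; rewrite mxE (bigD1 j) //= (bigD1 j') /=; last first.
  by rewrite -val_eqE /= ji j'i gtn_eqF.
rewrite !mxE big1 => [|k /andP[kj kj']].
  rewrite ji j'i !eqxx ltn_eqF // gtn_eqF //=; ring.
rewrite mxE -j'i -ji; move: kj kj'; rewrite -!val_eqE /= => /negPf-> /negPf->.
by rewrite subrr mulr0 mul0r.
Qed.

Lemma gradient_quadratic {R : realType} (n : nat) (f : 'cV[R]_n -> R)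
    (A : 'M[R]_n) (c : R) (x : 'cV[R]_n) :
  A^T = A -> (forall y, f y = 2^-1 * (y^T *m A *m y) 0 0 + c) ->
  gradient f x = A *m x.
Proof.
move=> As fE; apply/matrixP => i j; rewrite ord1 mxE {j}.
set v := delta_mx i 0; apply: cvg_lim; first exact: norm_hausdorff.
have key (h : R) : f (h *: v + x) - f x =
    h * ((A *m x) i 0 + h * (2^-1 * A i i)).
  rewrite !fE [(_ + _)^T]linearD /= [(_ *: _)^T]linearZ /=.
  rewrite !mulmxDl !mulmxDr -!scalemxAl -!scalemxAr.
  have addE (B C : 'M[R]_1) : (B + C) 0 0 = B 0 0 + C 0 0 by rewrite mxE.
  have scaleE (k : R) (B : 'M[R]_1) : (k *: B) 0 0 = k * B 0 0 by rewrite mxE.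
  have E1 : (v^T *m A *m x) 0 0 = (A *m x) i 0.
    by rewrite -mulmxA /v trmx_delta -rowE mxE.
  have E2 : (x^T *m A *m v) 0 0 = (A *m x) i 0.
    have -> : x^T *m A *m v = (v^T *m A *m x)^T.
      by rewrite !trmx_mul As trmxK mulmxA.
    by rewrite mxE E1.
  have E3 : (v^T *m A *m v) 0 0 = A i i.
    by rewrite /v trmx_delta -rowE -colE !mxE.
  rewrite !addE !scaleE E1 E2 E3; by field.
have lim0 : (fun h : R => (A *m x) i 0 + h * (2^-1 * A i i)) @ 0^'
    --> (A *m x) i 0.
  have h0 : (fun h : R => h) @ (0 : R)^' --> (0 : R).
    by apply: cvg_within_filter; exact: cvg_id.
  have := cvgD (cvg_cst ((A *m x) i 0 : R))
    (cvgM h0 (cvg_cst (2^-1 * A i i : R))).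
  by rewrite mul0r addr0; apply.
apply: (cvg_trans _ lim0); apply: near_eq_cvg; near=> h.
rewrite /= key /GRing.scale /= mulKf //.
by near: h; exact: nbhs_dnbhs_neq.
Unshelve. all: by end_near. Qed.

Lemma dlaplacian_sym {R : realType} (N : nat) :
  (dlaplacian N : 'M[R]_N)^T = dlaplacian N.
Proof. by rewrite /dlaplacian linearN /= trmx_mul trmxK. Qed.

Lemma mass_sym {R : realType} (N : nat) (nu : R) :
  (mass N nu)^T = mass N nu.
Proof.
by rewrite /mass linearB /= linearZ /= trmx1 dlaplacian_sym.
Qed.

Lemma gradient_hamiltonian_q {R : realType} (N : nat) (nu : R)
    (p q : 'cV[R]_N) :
  gradient (hamiltonian nu p) q = - (dlaplacian N *m q).
Proof.
rewrite -mulNmx; apply: (@gradient_quadratic _ _ _ _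
  (2^-1 * (p^T *m invmx (mass N nu) *m p) 0 0)) => [|y].
  by rewrite linearN /= dlaplacian_sym.
rewrite /hamiltonian addrC; congr (_ + _).
rewrite /dlaplacian opprK mulmxA -trmx_mul -mulmxA mxE mulr_sumr.
by apply: eq_bigr => i _; rewrite /v_int [in RHS]mxE expr2 mulrC.
Qed.

Lemma gradient_hamiltonian_p {R : realType} (N : nat) (nu : R)
    (p q : 'cV[R]_N) :
  gradient ((hamiltonian nu) ^~ q) p = invmx (mass N nu) *m p.
Proof.
apply: gradient_quadratic => [|y]; last by [].
by rewrite trmx_inv mass_sym.
Qed.

Lemma leapfrog_hamiltonianE {R : realType} (N : nat) (nu dt : R)
    (p q : 'cV[R]_N) :
  leapfrog (hamiltonian nu) dt p q =
  let p_half := p + (dt / 2) *: (dlaplacian N *m q) in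
  let q_new := q + dt *: (invmx (mass N nu) *m p_half) in
  let p_new := p_half + (dt / 2) *: (dlaplacian N *m q_new) in
  (p_new, q_new).
Proof.
by rewrite /leapfrog !gradient_hamiltonian_q gradient_hamiltonian_p
  !scalerN !opprK.
Qed.

(* Main.v *)
Require Import Defs.
From mathcomp Require Import all_boot all_order all_algebra.
From mathcomp Require Import all_classical all_reals all_analysis.
From mathcomp Require Import complex ring lra.
Set Implicit Arguments.
Unset Strict Implicit.
Unset Printing Implicit Defensive.
Import Order.TTheory GRing.Theory Num.Theory.
Local Open Scope ring_scope.

(* The vectors cos((j + 1/2) k pi / N), 0 <= k < N, diagonalize - Delta_d with
   distinct eigenvalues lambda_k = 4 N^2 sin^2(k pi / 2N), hence also the mass
   matrix.  The one-step map is kick * drift * kick, where kick and drift are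
   block matrices in Delta_d and M^-1, so it splits into 2 x 2 blocks of
   determinant 1 and trace 2 - dt^2 lambda_k / (1 + nu^2 lambda_k).  The
   spectrum of a real 2 x 2 matrix of determinant 1 lies in the closed unit disk
   iff its trace is at most 2 in absolute value; here this says
   lambda_k (dt^2 - 4 nu^2) <= 4, and k = N - 1 is the worst case. *)

(** * Spectra of 2 x 2 matrices of determinant 1 *)

Lemma lift0_ord2 : (lift 0 0 = 1 :> 'I_2) * (lift 1 0 = 0 :> 'I_2).
Proof. by split; apply: val_inj. Qed.

Lemma det_mx2 (R : comNzRingType) (A : 'M[R]_2) :
  \det A = A 0 0 * A 1 1 - A 0 1 * A 1 0.
Proof.
rewrite (expand_det_row _ 0) !big_ord_recl big_ord0 /cofactor !det_mx11 !mxE.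
by rewrite !lift0_ord2 /=; ring.
Qed.

Lemma mxtrace_mx2 (R : nmodType) (A : 'M[R]_2) : \tr A = A 0 0 + A 1 1.
Proof. by rewrite /mxtrace !big_ord_recl big_ord0 !lift0_ord2 addr0. Qed.

Lemma eigenvalue_mx2 (F : fieldType) (A : 'M[F]_2) (l : F) :
  eigenvalue A l = (l ^+ 2 - \tr A * l + \det A == 0).
Proof.
rewrite eigenvalue_root_char /char_poly /root det_mx2 mxtrace_mx2 det_mx2 !mxE.
rewrite /= !(mulr0n, mulr1n, hornerD, hornerN, hornerM, hornerX, hornerC).
by congr (_ == 0); ring.
Qed.

(** The eigenvalues have product 1: a trace beyond 2 in modulus gives two real ones, one outside the
    disk; otherwise they are conjugate on the circle or a double root 1 or -1. *)
Lemma unimodular_mx2_stable (R : rcfType) (A : 'M[R]_2) : \det A = 1 ->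
  (forall l : R[i], eigenvalue (map_mx (real_complex R) A) l -> `|l| <= 1) <->
  `|\tr A| <= 2.
Proof.
move=> detA; set t := \tr A.
have eigE l : eigenvalue (map_mx (real_complex R) A) l =
    (l ^+ 2 - (real_complex R t) * l + 1 == 0).
  by rewrite eigenvalue_mx2 det_map_mx trace_map_mx detA rmorph1.
split=> [stab|].
  rewrite leNgt; apply/negP => t2.
  have t4 : 0 <= t ^+ 2 - 4.
    by rewrite -real_normK ?num_real //; nra.
  have s2 := sqr_sqrtr t4; have := sqrtr_ge0 (t ^+ 2 - 4).
  set s := Num.sqrt _ in s2 *; move=> s0.
  (* The root of larger modulus: the sign of [t] makes both terms add up, so its modulus is at least
     [|t| / 2 > 1]. *)
  pose a := (t + Num.sg t * s) / 2.
  have /stab : eigenvalue (map_mx (real_complex R) A) (real_complex R a).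
    rewrite eigE -rmorphXn -rmorphM -rmorphB -(rmorph1 (real_complex R)).
    rewrite -rmorphD fmorph_eq0 /a.
    case: (sgrP t) t2 => [->|tp t2|tn t2]; first by lra.
      by apply/eqP; field: s2.
    by apply/eqP; field: s2.
  rewrite normc_def /= expr0n addr0 sqrtr_sqr lecR /a => a1.
  move: t2 a1; case: (sgrP t) => [->|tp|tn]; first by lra.
    by rewrite gtr0_norm; lra.
  by rewrite ltr0_norm; lra.
move=> t2 [a b]; rewrite eigE eq_complex /= => /andP[/eqP ha /eqP hb].
rewrite normc_def /= -[1 in leRHS]/((1 : R)%:C)%C lecR -[leRHS]sqrtr1 ler_sqrt //.
move: t2; rewrite ler_norml => /andP[t2 t3].
(* A real root satisfies [a ^+ 2 + 1 = t * a], so [|t| <= 2] forces [(a - 1) ^+ 2 <= 0] or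
   [(a + 1) ^+ 2 <= 0], according to the sign of [a]. *)
have [b0|b0] := eqVneq b 0.
  subst b; have {}ha : a ^+ 2 + 1 = t * a by rewrite -[RHS]addr0 -ha; ring.
  rewrite expr0n addr0; have [a0|a0] := lerP 0 a.
    suff -> : a = 1 by rewrite expr1n.
    by apply/eqP; rewrite -subr_eq0 -sqrf_eq0 eq_le sqr_ge0 andbT; nra.
  suff -> : a = - 1 by rewrite sqrrN expr1n.
  by apply/eqP; rewrite -addr_eq0 -sqrf_eq0 eq_le sqr_ge0 andbT; nra.
(* The imaginary part is [b * (2 * a - t)]; once [t = 2 * a], the real part says that
   [a ^+ 2 + b ^+ 2 = 1]. *)
have ta : t = 2 * a by apply: (mulfI b0); lra.
by subst t; nra.
Qed.

(** * The leapfrog matrix and its splitting into modes *)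

(** [S] stands for the Laplacian and [K] for the inverse mass. The size is left free so that the
    block of a single mode is the instance with 1 x 1 scalar matrices. *)
Definition leapfrog_mx (R : fieldType) (n : nat) (S K : 'M[R]_n) (dt : R) :
    'M[R]_(n + n) :=
  let kick := block_mx 1%:M ((dt / 2) *: S) 0 1%:M in
  kick *m block_mx 1%:M 0 (dt *: K) 1%:M *m kick.

Lemma det_leapfrog_mx (R : fieldType) (n : nat) (S K : 'M[R]_n) (dt : R) :
  \det (leapfrog_mx S K dt) = 1.
Proof. by rewrite !det_mulmx !det_ublock det_lblock !det1 !mulr1. Qed.

(** [C] is rectangular on purpose: a column of the eigenbasis restricts to one mode, a row of its
    inverse extends from one mode. *)
Lemma leapfrog_mx_intertwine (R : fieldType) (m n : nat) (S K : 'M[R]_n)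
    (S' K' : 'M[R]_m) (dt : R) (C : 'M[R]_(n, m)) :
  S *m C = C *m S' -> K *m C = C *m K' ->
  leapfrog_mx S K dt *m block_mx C 0 0 C =
  block_mx C 0 0 C *m leapfrog_mx S' K' dt.
Proof.
move=> SC KC; rewrite /leapfrog_mx.
have kick a : block_mx 1%:M (a *: S) 0 1%:M *m block_mx C 0 0 C =
              block_mx C 0 0 C *m block_mx 1%:M (a *: S') 0 1%:M.
  by rewrite !mulmx_block !(mul1mx, mulmx1, mul0mx, mulmx0, addr0, add0r)
    -scalemxAl -scalemxAr SC.
have drift : block_mx 1%:M 0 (dt *: K) 1%:M *m block_mx C 0 0 C =
             block_mx C 0 0 C *m block_mx 1%:M 0 (dt *: K') 1%:M.
  by rewrite !mulmx_block !(mul1mx, mulmx1, mul0mx, mulmx0, addr0, add0r)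
    -scalemxAl -scalemxAr KC.
by rewrite -!mulmxA kick !mulmxA -(mulmxA _ _ (block_mx C _ _ _)) drift !mulmxA
  kick.
Qed.

Lemma leapfrog_mx_scalar_tr (R : numFieldType) (s k dt : R) :
  \tr (leapfrog_mx s%:M k%:M dt : 'M[R]_(1 + 1)) = 2 + dt ^+ 2 * s * k.
Proof.
rewrite /leapfrog_mx !mulmx_block mxtrace_block /mxtrace !big_ord1.
rewrite !(mul1mx, mulmx1, mul0mx, mulmx0, addr0, add0r).
rewrite -!scalemxAl -!scalemxAr -!scalar_mxM !mxE /= !mulr1n.
by field.
Qed.

Lemma col_mulmx (R : pzSemiRingType) (m n p : nat) (A : 'M[R]_(m, n))
    (B : 'M[R]_(n, p)) (j : 'I_p) : col j (A *m B) = A *m col j B.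
Proof. by rewrite !colE mulmxA. Qed.

(** Row eigenvectors are transported by intertwining: from a block to the full matrix along row [i]
    of [invmx V], and back along column [i] of [V]. *)
Lemma eigenvalue_leapfrog_mx (R F : fieldType) (f : {rmorphism R -> F})
    (n : nat) (S K V : 'M[R]_n) (s k : 'rV[R]_n) (dt : R) (l : F) :
  V \in unitmx -> S *m V = V *m diag_mx s -> K *m V = V *m diag_mx k ->
  eigenvalue (map_mx f (leapfrog_mx S K dt)) l <->
  exists i, eigenvalue
    (map_mx f (leapfrog_mx (s 0 i)%:M (k 0 i)%:M dt : 'M[R]_(1 + 1))) l.
Proof.
move=> Vu SV KV.
have colV A (d : 'rV[R]_n) i : A *m V = V *m diag_mx d ->
    A *m col i V = col i V *m (d 0 i)%:M.
  move=> AV; rewrite mul_mx_scalar -!col_mulmx AV.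
  by apply/colP => j; rewrite mul_mx_diag !mxE mulrC.
have rowV A (d : 'rV[R]_n) i : A *m V = V *m diag_mx d ->
    (d 0 i)%:M *m row i (invmx V) = row i (invmx V) *m A.
  move=> AV; rewrite mul_scalar_mx -row_mul.
  have -> : invmx V *m A = diag_mx d *m invmx V.
    by rewrite -[LHS](mulmxK Vu) -(mulmxA _ A) AV mulKmx.
  by apply/rowP => j; rewrite mul_diag_mx !mxE.
have col_eq0 (x : 'rV[F]_n) : (forall i, x *m map_mx f (col i V) = 0) -> x = 0.
  move=> x0; have uV : map_mx f V \in unitmx by rewrite map_unitmx.
  rewrite -[x](mulmxK uV); suff -> : x *m map_mx f V = 0 by rewrite mul0mx.
  apply/rowP => i; have := x0 i; rewrite map_col -col_mulmx => /colP/(_ 0).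
  by rewrite !mxE.
pose D p q (X : 'M[R]_(p, q)) := block_mx X 0 0 X.
split=> [/eigenvalueP[u ul u0]|[i /eigenvalueP[w wl w0]]]; last first.
  apply/eigenvalueP; exists (w *m map_mx f (D _ _ (row i (invmx V)))).
    rewrite -mulmxA -map_mxM.
    rewrite -(leapfrog_mx_intertwine _ (rowV _ _ i SV) (rowV _ _ i KV)).
    by rewrite map_mxM mulmxA wl -scalemxAl.
  (* The extension has a left inverse on the mode, so it cannot kill [w]. *)
  have rc : row i (invmx V) *m col i V = 1%:M.
    rewrite -row_mul -col_mulmx mulVmx //.
    by apply/matrixP => a b; rewrite !ord1 !mxE eqxx.
  apply: contra_neq w0 => w0.
  have : w *m map_mx f (D _ _ (row i (invmx V)) *m D _ _ (col i V)) = 0.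
    by rewrite map_mxM mulmxA w0 mul0mx.
  rewrite mulmx_block !mulmx0 !mul0mx !addr0 !add0r rc -scalar_mx_block map_mx1.
  by rewrite mulmx1.
(* If every column killed [u], both halves of [u] would be annihilated by the invertible [V]. *)
have [i wi0] : exists i, u *m map_mx f (D _ _ (col i V)) != 0.
  apply: contrapT => h; case/negP: u0; apply/eqP.
  have {}h i : u *m map_mx f (D _ _ (col i V)) = 0.
    by apply/eqP/negPn/negP => wi; apply: h; exists i.
  have {}h i : (lsubmx u *m map_mx f (col i V) = 0) /\
               (rsubmx u *m map_mx f (col i V) = 0).
    have := h i; rewrite -{1}[u]hsubmxK map_block_mx !map_mx0 mul_row_block.
    by rewrite !mulmx0 addr0 add0r -row_mx0 => /eq_row_mx.
  rewrite -[u]hsubmxK [lsubmx u]col_eq0 => [|i]; last by case: (h i).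
  by rewrite [rsubmx u]col_eq0 ?row_mx0 // => i; case: (h i).
exists i; apply/eigenvalueP; exists (u *m map_mx f (D _ _ (col i V))) => //.
rewrite -mulmxA -map_mxM.
rewrite -(leapfrog_mx_intertwine _ (colV _ _ i SV) (colV _ _ i KV)).
by rewrite map_mxM mulmxA ul -scalemxAl.
Qed.

(** * Diagonalization of the discrete Neumann Laplacian and of the mass matrix *)

(** Eigenvectors of a symmetric matrix for distinct eigenvalues are orthogonal, so the Gram matrix
    is diagonal with positive entries. This spares the trigonometric sums. *)
Lemma sym_eigenbasis_unitmx (R : realFieldType) (n : nat) (S V : 'M[R]_n)
    (s : 'rV[R]_n) :
  S^T = S -> S *m V = V *m diag_mx s -> injective (s 0) ->
  (forall i, col i V != 0) -> V \in unitmx.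
Proof.
move=> Ssym SV s_inj V0; set G := V^T *m V.
have Gcomm : G *m diag_mx s = diag_mx s *m G.
  by rewrite /G -mulmxA -SV mulmxA -{1}Ssym -trmx_mul SV trmx_mul tr_diag_mx
    mulmxA.
have Goff i j : i != j -> G i j = 0.
  move=> ij; have := congr1 (fun A : 'M[R]_n => A i j) Gcomm.
  rewrite /= mul_mx_diag mul_diag_mx !mxE => /eqP.
  rewrite mulrC -subr_eq0 -mulrBl mulf_eq0 subr_eq0.
  case/orP => [/eqP/s_inj ji|/eqP //].
  by rewrite ji eqxx in ij.
have Gdiag i : 0 < G i i.
  rewrite lt_def /G mxE; under eq_bigr do rewrite mxE -expr2.
  rewrite sumr_ge0 ?andbT => [|j _]; last exact: sqr_ge0.
  rewrite psumr_eq0 => [|j _]; last exact: sqr_ge0.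
  apply: contra (V0 i) => /allP h; apply/eqP/colP => j; rewrite !mxE.
  by apply/eqP; rewrite -sqrf_eq0; apply: h; rewrite mem_index_enum.
have GE : G = diag_mx (\row_i G i i).
  apply/matrixP => i j; rewrite [RHS]mxE [X in X *+ _]mxE.
  have [->|ij] := eqVneq i j => //.
  by rewrite Goff.
have : \det G != 0.
  rewrite GE det_diag; apply/prodf_neq0 => i _.
  by rewrite mxE lt0r_neq0.
by rewrite unitmxE unitfE det_mulmx mulf_eq0 negb_or => /andP[].
Qed.

Lemma sin_natpi (R : realType) (n : nat) : sin (n%:R * pi) = 0 :> R.
Proof.
elim: n => [|n IHn]; first by rewrite mul0r sin0.
by rewrite -natr1 mulrDl mul1r sinD IHn sinpi mul0r mulr0 addr0.
Qed.

Definition neumann_mode (R : realType) (N : nat) : 'M[R]_N :=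
  \matrix_(j, k) cos ((j.*2.+1)%:R * (k%:R * pi / (2 * N%:R))).

Definition neumann_eig (R : realType) (N : nat) : 'rV[R]_N :=
  \row_k (4 * N%:R ^+ 2 * sin (k%:R * pi / (2 * N%:R)) ^+ 2).

Lemma dlaplacian_eig (R : realType) (N : nat) :
  dlaplacian N *m neumann_mode R N =
  neumann_mode R N *m diag_mx (- neumann_eig R N).
Proof.
case: N => [|n]; first by apply/matrixP => -[].
apply/matrixP => j k; rewrite mul_mx_diag.
set x : R := k%:R * pi / (2 * n.+1%:R).
(* F m is the flux N (q_m - q_(m-1)) of mode k; it vanishes at both ends, which
   is where the Neumann boundary condition enters. *)
pose F m : R := - (2 * n.+1%:R * sin x * sin (m.*2%:R * x)).
have F0 : F 0%N = 0 by rewrite /F mul0r sin0 mulr0 oppr0.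
have FN : F n.+1 = 0.
  rewrite /F (_ : _ * x = k%:R * pi) ?sin_natpi ?mulr0 ?oppr0 //.
  have : n.+1%:R != 0 :> R by rewrite pnatr_eq0.
  by rewrite /x -mul2n natrM; move: n.+1%:R => y y0; field.
have DV (i : 'I_n) : (dgrad n.+1 *m col k (neumann_mode R n.+1)) i 0 = F i.+1.
  have hi : (i < n.+1)%N by rewrite ltnS ltnW.
  pose i' : 'I_n.+1 := Ordinal (ltn_ord i : (i.+1 < n.+1)%N).
  rewrite (@dgradE _ _ _ _ (Ordinal hi) i') //.
  rewrite !mxE /= -/x /F.
  (* Both node angles are centred at the midpoint between the nodes, so that the difference of
     cosines becomes a product of sines. *)
  rewrite (_ : (i.+1.*2.+1)%:R * x = (i.+1.*2)%:R * x + x); last first.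
    by rewrite -natr1; ring.
  rewrite (_ : (i.*2.+1)%:R * x = (i.+1.*2)%:R * x - x); last first.
    by rewrite doubleS -[in RHS]natr1; ring.
  by rewrite cosD cosB; ring.
have sumF (G : nat -> R) : \sum_(i < n.+1) (j == i)%:R * G i = G j.
  rewrite (bigD1 j) //= eqxx mul1r big1 ?addr0 // => i ij.
  by rewrite eq_sym (negbTE ij) mul0r.
have -> : (dlaplacian n.+1 *m neumann_mode R n.+1) j k =
    n.+1%:R * (F j.+1 - F j).
  transitivity
    (- ((dgrad n.+1)^T *m (dgrad n.+1 *m col k (neumann_mode R n.+1))) j 0).
    by rewrite mulmxA -col_mulmx /dlaplacian mulNmx !mxE.
  rewrite mxE; under eq_bigr => i _ do
    rewrite DV mxE mxE mulrBr mulrBl -!mulrA.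
  (* Each of the two sums over the [n] edges is completed to [n.+1] terms by a vanishing boundary
     flux, and then the Kronecker symbol selects one term. *)
  rewrite sumrB -!mulr_sumr -mulrBr -mulrN opprB; congr (_ * (_ - _)).
    by rewrite -[RHS](sumF (F \o S)) big_ord_recr /= FN mulr0 addr0.
  by rewrite -[RHS](sumF F) big_ord_recl /= F0 mulr0 add0r.
rewrite !mxE -/x /F.
rewrite (_ : (j.+1.*2)%:R * x = (j.*2.+1)%:R * x + x); last first.
  by rewrite doubleS -[in LHS]natr1; ring.
rewrite (_ : (j.*2)%:R * x = (j.*2.+1)%:R * x - x); last first.
  by rewrite -natr1; ring.
by rewrite sinD sinB; ring.
Qed.

(** On this range sine is increasing and cosine is positive. *)
Lemma neumann_angle_bounds (R : realType) (N : nat) (k : 'I_N) :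
  0 <= (k%:R * pi / (2 * N%:R) : R) < pi / 2.
Proof.
have N0 : (0 : R) < N%:R by rewrite ltr0n (leq_trans _ (ltn_ord k)).
have kN : (k%:R : R) < N%:R by rewrite ltr_nat.
have pi0 := pi_gt0 R.
rewrite divr_ge0 ?mulr_ge0 ?ler0n ?pi_ge0 //=.
rewrite ltr_pdivrMr ?mulr_gt0 // (_ : _ * (_ * _) = N%:R * pi); last by field.
by rewrite ltr_pM2r.
Qed.

Lemma neumann_eig_ge0 (R : realType) (N : nat) (k : 'I_N) :
  0 <= neumann_eig R N 0 k.
Proof. by rewrite mxE mulr_ge0 ?sqr_ge0 // mulr_ge0 ?sqr_ge0. Qed.

(** Serves twice: for the distinctness of the eigenvalues and for the choice of the worst mode. *)
Lemma ler_neumann_eig (R : realType) (N : nat) (j k : 'I_N) :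
  (neumann_eig R N 0 j <= neumann_eig R N 0 k) = (j <= k)%N.
Proof.
have N0 : (0 : R) < N%:R by rewrite ltr0n (leq_trans _ (ltn_ord k)).
have pi0 := pi_gt0 R.
have /andP[j0 jpi] := neumann_angle_bounds R j.
have /andP[k0 kpi] := neumann_angle_bounds R k.
rewrite !mxE ler_pM2l ?mulr_gt0 ?exprn_gt0 //.
rewrite ler_sqr ?nnegrE ?sin_ge0_pi //; try lra.
rewrite !leNgt ltr_sin ?in_itv /= -?leNgt; try lra.
by rewrite ler_pM2r ?invr_gt0 ?mulr_gt0 // ler_pM2r // ler_nat.
Qed.

Lemma neumann_mode_unitmx (R : realType) (N : nat) :
  neumann_mode R N \in unitmx.
Proof.
apply: (sym_eigenbasis_unitmx (dlaplacian_sym N) (dlaplacian_eig R N)).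
  move=> j k; rewrite !mxE => /oppr_inj jk; apply/val_inj/eqP.
  by rewrite eqn_leq -!(ler_neumann_eig R) !mxE jk lexx.
(* The first entry of each mode is the cosine of an angle below [pi / 2], hence nonzero. *)
case: N => [[]//|n] k; apply/eqP => /colP/(_ 0); rewrite !mxE mul1r => /eqP.
have /andP[k0 kpi] := neumann_angle_bounds R k; have pi0 := pi_gt0 R.
rewrite gt_eqF // cos_gt0_pihalf // kpi andbT (lt_le_trans _ k0) //.
by rewrite oppr_lt0 divr_gt0.
Qed.

Lemma mass_eig (R : realType) (N : nat) (nu : R) :
  mass N nu *m neumann_mode R N =
  neumann_mode R N *m diag_mx (\row_k (1 + nu ^+ 2 * neumann_eig R N 0 k)).
Proof.
rewrite mulmxBl mul1mx -scalemxAl dlaplacian_eig.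
by apply/matrixP => i j; rewrite !mul_mx_diag !mxE; ring.
Qed.

Lemma invmx_mass_eig (R : realType) (N : nat) (nu : R) :
  invmx (mass N nu) *m neumann_mode R N =
  neumann_mode R N *m diag_mx (\row_k (1 + nu ^+ 2 * neumann_eig R N 0 k)^-1).
Proof.
have Vu := neumann_mode_unitmx R N.
have mu0 k : 1 + nu ^+ 2 * neumann_eig R N 0 k != 0.
  by rewrite lt0r_neq0 // ltr_pwDl // mulr_ge0 ?sqr_ge0 ?neumann_eig_ge0.
(* [invmx] returns a singular matrix unchanged, so invertibility has to be established; it comes
   from the positive eigenvalues. *)
have Mu : mass N nu \in unitmx.
  suff : mass N nu *m neumann_mode R N \in unitmx.
    by rewrite unitmx_mul => /andP[].
  rewrite mass_eig unitmx_mul Vu unitmxE det_diag unitfE.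
  by apply/prodf_neq0 => k _; rewrite mxE.
apply: (canLR (mulKmx Mu)); rewrite mulmxA mass_eig -mulmxA.
rewrite mulmx_diag -[LHS]mulmx1; congr (_ *m _).
rewrite -diag_const_mx; congr diag_mx; apply/rowP => i.
rewrite [LHS]mxE [RHS]mxE; have := mu0 i.
by rewrite !mxE => /mulfV.
Qed.

(** * From the one-step map to the time step bound *)

Lemma one_step_map_hamiltonianE (R : realType) (N : nat) (nu dt : R) z :
  one_step_map (@hamiltonian R N nu) dt z =
  leapfrog_mx (dlaplacian N) (invmx (mass N nu)) dt *m z.
Proof.
rewrite /one_step_map leapfrog_hamiltonianE /leapfrog_mx -[z in RHS]vsubmxK.
rewrite -!mulmxA !mul_block_col !mul1mx !mul0mx add0r addr0.
by rewrite -!scalemxAl add0r /= [dsubmx z + _]addrC.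
Qed.

Lemma mulmx_inj (R : pzSemiRingType) (m n : nat) (A B : 'M[R]_(m, n)) :
  (forall z : 'cV_n, A *m z = B *m z) -> A = B.
Proof.
by move=> AB; apply/matrixP => i j; have := AB (delta_mx j 0);
  rewrite -!colE => /colP/(_ i); rewrite !mxE.
Qed.

(** A linear map determines its matrix, so the existential in [spectrally_stable] can be tested on
    any known one. *)
Lemma spectrally_stable_linear (R : realType) (m : nat) (A : 'M[R]_m)
    (Phi : 'cV[R]_m -> 'cV[R]_m) : (forall z, Phi z = A *m z) ->
  spectrally_stable Phi <->
  forall l : R[i], eigenvalue (map_mx (real_complex R) A) l -> `|l| <= 1.
Proof.
move=> PhiA; split=> [[B PhiB stabB]|stabA]; last by exists A.
by rewrite (@mulmx_inj _ _ _ A B) // => z; rewrite -PhiA.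
Qed.

(** The subtracted quotient is nonnegative, so only the bound -2 matters; clearing the positive
    denominator leaves a condition linear in [lam]. *)
Lemma trace_stable_leapfrog (R : realFieldType) (dt lam nu : R) :
  0 <= lam ->
  `|2 - dt ^+ 2 * lam / (1 + nu ^+ 2 * lam)| <= 2 <->
  lam * (dt ^+ 2 - 4 * nu ^+ 2) <= 4.
Proof.
move=> lam0; have mu0 : 0 < 1 + nu ^+ 2 * lam.
  by rewrite ltr_pwDl // mulr_ge0 ?sqr_ge0.
have q0 : 0 <= dt ^+ 2 * lam / (1 + nu ^+ 2 * lam).
  by apply: divr_ge0; [apply: mulr_ge0 => //; apply: sqr_ge0|apply: ltW].
transitivity (is_true (dt ^+ 2 * lam / (1 + nu ^+ 2 * lam) <= 4)).
  by rewrite ler_norml; split=> [/andP[]|?]; first lra; apply/andP; split; lra.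
by rewrite ler_pdivrMr //; split; lra.
Qed.

Theorem proposition7p2 (R : realType) (N : nat) (nu dt : R) :
  (2 <= N)%N -> 0 <= nu -> 0 < dt ->
  spectrally_stable (one_step_map (@hamiltonian R N nu) dt) <->
  dt <= Num.sqrt (4 * nu ^+ 2
          + 1 / (N%:R ^+ 2 * sin ((N%:R - 1) * pi / (2 * N%:R)) ^+ 2)).
Proof.
move=> N2 nu0 dt0.
pose L k : 'M[R]_(1 + 1) := leapfrog_mx ((- neumann_eig R N) 0 k)%:M
  ((\row_i (1 + nu ^+ 2 * neumann_eig R N 0 i)^-1) 0 k)%:M dt.
have detL k : \det (L k) = 1 by exact: det_leapfrog_mx.
have trL k : `|\tr (L k)| <= 2 <->
    neumann_eig R N 0 k * (dt ^+ 2 - 4 * nu ^+ 2) <= 4.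
  have sE : (- neumann_eig R N) 0 k = - neumann_eig R N 0 k by rewrite [LHS]mxE.
  have kE : (\row_k (1 + nu ^+ 2 * neumann_eig R N 0 k)^-1) 0 k =
      (1 + nu ^+ 2 * neumann_eig R N 0 k)^-1 by rewrite [LHS]mxE.
  rewrite /L leapfrog_mx_scalar_tr sE kE mulrN mulNr.
  exact: trace_stable_leapfrog (neumann_eig_ge0 R k).
have top_lt : (N.-1 < N)%N by rewrite ltn_predL ltnW.
pose top := Ordinal top_lt.
have topE : neumann_eig R N 0 top =
    4 * (N%:R ^+ 2 * sin ((N%:R - 1) * pi / (2 * N%:R)) ^+ 2).
  have topR : top%:R = N%:R - 1 :> R by rewrite /top /= -subn1 natrB // ltnW.
  by rewrite mxE topR mulrA.
(* Here [2 <= N] enters: the top mode differs from the zero mode. *)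
have top_gt0 : 0 < neumann_eig R N 0 top.
  rewrite lt_def neumann_eig_ge0 andbT; apply/eqP => top0.
  have := ler_neumann_eig R top (Ordinal (ltnW N2)).
  by rewrite top0 neumann_eig_ge0 /= leqn0 -subn1 subn_eq0 leqNgt N2.
have stabE := spectrally_stable_linear (one_step_map_hamiltonianE nu dt).
have dtE : (dt <= Num.sqrt (4 * nu ^+ 2
      + 1 / (N%:R ^+ 2 * sin ((N%:R - 1) * pi / (2 * N%:R)) ^+ 2))) =
    (neumann_eig R N 0 top * (dt ^+ 2 - 4 * nu ^+ 2) <= 4).
  have -> : 1 / (N%:R ^+ 2 * sin ((N%:R - 1) * pi / (2 * N%:R)) ^+ 2) =
      4 / neumann_eig R N 0 top.
    by rewrite topE [(4 * _)^-1]invfM [RHS]mulrA divff ?pnatr_eq0.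
  rewrite -[X in X <= _](gtr0_norm dt0) -sqrtr_sqr ler_sqrt.
    by rewrite -lerBlDl ler_pdivlMr // mulrC.
  by rewrite addr_ge0 ?mulr_ge0 ?sqr_ge0 // invr_ge0 ltW.
rewrite dtE {dtE}; have eigE l := eigenvalue_leapfrog_mx (real_complex R) dt l
  (neumann_mode_unitmx R N) (dlaplacian_eig R N) (invmx_mass_eig N nu).
split=> [/stabE stab|top_le].
  apply/trL/(unimodular_mx2_stable (detL top)) => l ll.
  by apply/stab/eigE; exists top.
apply/stabE => l /eigE[k]; move: l; apply/(unimodular_mx2_stable (detL k))/trL.
(* If the factor is nonnegative, the condition is most restrictive at the largest eigenvalue; if it
   is negative, the left side is at most 0 for every mode. *)
have [d0|d0] := leP 0 (dt ^+ 2 - 4 * nu ^+ 2).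
  apply: le_trans top_le; rewrite ler_wpM2r // ler_neumann_eig.
  by rewrite -ltnS prednK // ltnW.
apply: le_trans (_ : 0 <= _) => //.
by rewrite mulr_ge0_le0 ?neumann_eig_ge0 // ltW.
Qed.
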